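(* If $G$ is an infinite abelian group in which every non-identity element is an involution, then $G$ has a directed $T_\infty$-terrace for any index set $I$ (in any ordered field) with $|I|=|G|$.
   Context: Let $\mathbb{F}$ be an ordered field and $I\subseteq\mathbb{F}$; for $d\in\mathbb{F}^+$ put $I_{(d)}=\{i\in I:i+d\in I\}$. $I$ is an index set if $|I|=|\mathbb{F}|$ and for every $d\in\mathbb{F}^+$ either $|I_{(d)}|=|\mathbb{F}|$ or $I_{(d)}=\emptyset$. A bijection $\mathbf a:I\to G$ is a directed $T_\infty$-terrace for $G$ if for every $d\in\mathbb{F}^+$ with $I_{(d)}\ne\emptyset$ the map $\mathbf a_{(d)}:I_{(d)}\to G\setminus\{e\}$, $\mathbf a_{(d)}(i)=\mathbf a(i)^{-1}\mathbf a(i+d)$, is a bijection. *)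

(* Defs.v *)
From mathcomp Require Import all_boot all_order all_algebra.
From mathcomp Require Import boolp classical_sets functions cardinality.

Set Implicit Arguments.
Unset Strict Implicit.
Unset Printing Implicit Defensive.

Local Open Scope classical_set_scope.
Local Open Scope card_scope.

Definition is_involution (G : groupType) (x : G) : Prop :=
  x <> 1%g /\ (x * x = 1)%g.

Definition shift_set (F : realFieldType) (I : set F) (d : F) : set F :=
  [set i | I i /\ I (i + d)%R].

Definition index_set (F : realFieldType) (I : set F) : Prop :=
  I #= [set: F] /\
  forall d : F, (0 < d)%R ->
    shift_set I d #= [set: F] \/ shift_set I d = set0.

(* A map I -> G is encoded as a total function a : F -> G; only its values on
   I are used, and the values outside I are irrelevant. *)
Definition directed_Tinf_terrace (F : realFieldType) (I : set F)
    (G : groupType) (a : F -> G) : Prop :=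
  set_bij I [set: G] a /\
  forall d : F, (0 < d)%R -> shift_set I d !=set0 ->
    set_bij (shift_set I d) (~` [set 1%g])
      (fun i : F => ((a i)^-1 * a (i + d)%R)%g).

(* Main.v *)
From Stdlib Require Import Inverse_Image.
Require Import Defs.
From mathcomp Require Import all_boot all_order all_algebra.
From mathcomp Require Import boolp classical_sets functions cardinality wochoice.
From mathcomp Require Import lra.

Import Order.TTheory.

Local Open Scope classical_set_scope.
Local Open Scope card_scope.

(** The terrace is built by transfinite recursion along a well-order of
    [F * G] all of whose initial segments have cardinality less than
    [kappa = |G|]. A stage is an injective partial map [S] from [I] to [G], of
    size less than [kappa], such that for each [d] the products
    [a(i) * a(i + d)] are pairwise distinct. Each step meets one requirement (a
    given [i] is in the domain, a given [x] is in the range, a given [g <> 1] is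
    attained at difference [d]) by adding at most two points. Each added point is
    free in a set of size [kappa], and by [kappa * kappa = kappa] fewer than
    [kappa] values are excluded. When [(i, x)] and [(i + d, x * g)] are added
    together, the coincidences forced for all choices of [i] and [x] would say
    that [g] was already attained at difference [d]. *)

(** * Cardinal arithmetic *)

(** Choice turns [R] into an injection, and [R] may relate one [x] to several [y]. This lets the
    graphs produced by Zorn's lemma be used directly. *)
Lemma card_le_rel {T U : Type} (A : set T) (B : set U) (R : T -> U -> Prop) :
  (forall x, A x -> exists2 y, B y & R x y) ->
  (forall x x' y, A x -> A x' -> R x y -> R x' y -> x = x') -> A #<= B.
Proof.
move=> Rtot Rinj.
have /choice[f fP] : forall x : A, exists y : B, R (set_val x) (set_val y).
  move=> x; have [y By Rxy] := Rtot _ (set_valP x).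
  by exists (SigSub (mem_set By)).
apply/card_leP/injfunPex; exists f => // x x' _ _ fxx'.
apply: val_inj; apply: (Rinj _ _ (set_val (f x))); rewrite -/(set_val _).
- exact: set_valP.
- exact: set_valP.
- exact: fP.
- rewrite fxx'; exact: fP.
Qed.

Lemma card_le_fun {T U : Type} (A : set T) (B : set U) (f : T -> U) :
  (forall x, A x -> B (f x)) ->
  (forall x x', A x -> A x' -> f x = f x' -> x = x') -> A #<= B.
Proof.
move=> fAB finj; apply: (@card_le_rel _ _ _ _ (fun x y => y = f x)).
  by move=> x Ax; exists (f x) => //; apply: fAB.
by move=> x x' y Ax Ax' -> /(finj _ _ Ax Ax').
Qed.

(** The injection is extended to all of [T] by the default [y0], which is why [B] has to be
    inhabited. *)
Lemma card_le_injection {T U : Type} {A : set T} {B : set U} :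
  B !=set0 -> A #<= B -> exists2 f : T -> U,
    forall x, A x -> B (f x) &
    forall x x', A x -> A x' -> f x = f x' -> x = x'.
Proof.
move=> [y0 By0] /card_leP/injfunPex[g _ ginj].
exists (fun x => if pselect (A x) is left Ax
                 then set_val (g (SigSub (mem_set Ax))) else y0).
  by move=> x Ax; case: pselect => // ?; apply: set_valP.
move=> x x' Ax Ax'; case: pselect => // ?; case: pselect => // ?.
by move=> /val_inj/ginj; rewrite !inE => /(_ I I)[].
Qed.

Lemma card_le_neq0 {T U : Type} (A : set T) (B : set U) :
  A !=set0 -> A #<= B -> B !=set0.
Proof.
move=> /set0P A0 AB; apply/set0P; apply: contra_neq A0 => B0.
by apply/eqP; rewrite -(card_le0 U) -B0.
Qed.

Lemma chain_common {T : Type} (C : set (set T)) (X Y : set T) :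
  total_on C subset -> C X -> C Y ->
  exists Z, [/\ C Z, X `<=` Z & Y `<=` Z].
Proof.
by move=> Ctot CX CY; have [?|?] := Ctot _ _ CX CY; [exists Y|exists X]; split.
Qed.

(** Zorn's lemma is applied to the sets [X] with [P (X0]|[X)]. Adjoining [X0] to a chain makes it
    nonempty, so [P] is only asked to be closed under unions of nonempty chains. *)
Lemma Zorn_bigcup_above {T : Type} (P : set (set T)) (X0 : set T) :
  P X0 ->
  (forall C, C !=set0 -> C `<=` P -> total_on C subset ->
     P (\bigcup_(X in C) X)) ->
  exists X, [/\ X0 `<=` X, P X & forall Y, X `<=` Y -> P Y -> Y `<=` X].
Proof.
move=> PX0 Pchain.
have [|X [PX Xmax]] := @Zorn_bigcup T [set X | P (X0 `|` X)].
  move=> C CP Ctot /=.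
  pose C' := X0 |` [set X0 `|` X | X in C].
  have -> : X0 `|` \bigcup_(X in C) X = \bigcup_(X in C') X.
    apply/seteqP; split=> [x [X0x|[X CX Xx]]|x [X [->|[Y CY <-]]]].
    - by exists X0 => //; left.
    - by exists (X0 `|` X); [right; exists X|right].
    - by left.
    - by case=> [?|Yx]; [left|right; exists Y].
  apply: Pchain; first by exists X0; left.
    by move=> X [->//|[Y CY <-]]; exact: CP.
  move=> X Y [->|[X' CX <-]] [->|[Y' CY <-]]; [by left|by left|by right|].
  by have [?|?] := Ctot _ _ CX CY; [left|right]; apply: setUS.
exists (X0 `|` X); split=> // Y XY PY.
apply: contrapT => nYX; apply: (Xmax Y).
  split; first exact: subset_trans XY.
  by apply: contra_not nYX => YX; apply: subset_trans YX _.
by rewrite /= (setUidPr _ _).2 //; apply: subset_trans XY.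
Qed.

(** A maximal graph of a partial injection from [A] to [B] is total on [A] or onto [B]: otherwise an
    unmatched pair [(x, y)] could be added to it. *)
Lemma card_le_total {T U : Type} (A : set T) (B : set U) :
  A #<= B \/ B #<= A.
Proof.
pose P := [set f : set (T * U) |
  (forall p, f p -> A p.1 /\ B p.2) /\
  (forall p q, f p -> f q -> p.1 = q.1 <-> p.2 = q.2)].
have [|f [[fAB finj] fmax]] := @Zorn_bigcup _ P.
  move=> C CP Ctot; split=> [p [X /CP[+ _]]|p q [X CX Xp] [Y CY Yq]]; first exact.
  have [Z [CZ XZ YZ]] := chain_common _ _ _ Ctot CX CY.
  by have [_] := CP _ CZ; apply; [apply: XZ|apply: YZ].
have [Atot|/existsNP[x /not_implyP[Ax nx]]] :=
    pselect (forall x, A x -> exists y, f (x, y)).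
  left; apply: (@card_le_rel _ _ _ _ (fun x y => f (x, y))).
    by move=> x /Atot[y fxy]; exists y => //; have [] := fAB _ fxy.
  by move=> ? ? ? _ _ f1 f2; apply/(finj _ _ f1 f2).
have [Btot|/existsNP[y /not_implyP[By ny]]] :=
    pselect (forall y, B y -> exists x, f (x, y)).
  right; apply: (@card_le_rel _ _ _ _ (fun y x => f (x, y))).
    by move=> ? /Btot[z fz]; exists z => //; have [] := fAB _ fz.
  by move=> ? ? ? _ _ f1 f2; apply/(finj _ _ f1 f2).
exfalso; apply: (fmax ((x, y) |` f)).
  split; first by move=> p; right.
  by move=> /(_ (x, y) (or_introl erefl)) fxy; apply: nx; exists y.
split=> [p [->//|/fAB//]|p q].
move=> [->|fp] [->|fq] //=; last exact: finj.
- split=> e; [case: nx; exists q.2|case: ny; exists q.1].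
    by rewrite e -surjective_pairing.
  by rewrite e -surjective_pairing.
- split=> e; [case: nx; exists p.2|case: ny; exists p.1].
    by rewrite -e -surjective_pairing.
  by rewrite -e -surjective_pairing.
Qed.

(** The points [u] and [v] serve as tags separating [B] from the rest of [A]. *)
Lemma card_setU_le {T : Type} (A B : set T) (u v : T) :
  B u -> B v -> u <> v -> A #<= B -> A `|` B #<= B `*` B.
Proof.
move=> Bu Bv uv AB.
have [|g gB ginj] := card_le_injection _ AB; first by exists u.
have in_A x : (A `|` B) x -> ~ B x -> A x by case.
apply: (@card_le_fun _ _ _ _
  (fun x => if pselect (B x) then (u, x) else (v, g x))).
  move=> x ABx; case: pselect => [?|nBx]; split=> //=.
  by apply: gB; apply: in_A.
move=> x x' ABx ABx'; case: pselect => Bx; case: pselect => Bx' [] //.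
- by move=> /esym.
- by apply: ginj; apply: in_A.
Qed.

(** Zorn's lemma gives a maximal injection of a square [X]*[X] into [X], with [X] inside [A]. If the
    rest of [A] is no larger than [X], then [A] injects into [X] and the bound for [X] carries over;
    if it is at least as large, the injection extends. *)
Lemma infinite_setX_le {T : Type} (A : set T) :
  infinite_set A -> A `*` A #<= A.
Proof.
move=> Ainf.
pose fld (f : set (T * T * T)) : set T := [set x | exists y, f (x, x, y)].
(* [f] is the graph of an injection from [fld f `*` fld f] to [fld f]; it need
   not be single-valued, since [card_le_rel] does not ask for it. *)
pose P := [set f : set (T * T * T) |
  [/\ forall p y, f (p, y) -> [/\ fld f p.1, fld f p.2 & fld f y],
      fld f `<=` A,
      forall x x', fld f x -> fld f x' -> exists y, f (x, x', y) &
      forall p p' y, f (p, y) -> f (p', y) -> p = p']].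
have fld_le f : P f -> fld f `*` fld f #<= fld f.
  move=> [f1 _ f3 f4].
  apply: (@card_le_rel _ _ _ _ (fun p y => f (p, y))) => [[x x'] [/= fx fx']|].
    by have [y fy] := f3 _ _ fx fx'; exists y => //; have [] := f1 _ _ fy.
  by move=> p p' y _ _; apply: f4.
have fldS f f' : f `<=` f' -> fld f `<=` fld f'.
  by move=> ff' x [y /ff' ?]; exists y.
have [i iA iinj] :
    exists2 i : nat -> T, forall n, A (i n) & injective i.
  have [|i iA iinj] := card_le_injection _ ((infiniteP A).1 Ainf).
    exact: infinite_setN0.
  by exists i => [n|n m /iinj]; [exact: iA|exact].
(* A countable seed, with pairs coded by [pickle]. Starting from it ensures that the maximal field
   has two distinct points to use as tags. *)
pose f0 := [set (i n, i m, i (pickle (n, m))) | n in [set: nat] & m in [set: nat]].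
have fld0 n : fld f0 (i n) by exists (i (pickle (n, n))); exists n => //; exists n.
have Pf0 : P f0.
  split.
  - by move=> _ _ [n _ [m _ [<- <-]]] /=; split.
  - by move=> x [y [n _ [m _ [<- _ _]]]]; apply: iA.
  - move=> _ _ [? [n _ [? _ [<- _ _]]]] [? [m _ [? _ [<- _ _]]]].
    by exists (i (pickle (n, m))); exists n => //; exists m.
  - move=> _ _ _ [n _ [m _ [<- <-]]] [n' _ [m' _ [<- /iinj]]].
    by move=> /(pcan_inj (@pickleK _))[-> ->].
have [|f [f0f Pf fmax]] := Zorn_bigcup_above P f0 Pf0.
  move=> C C0 CP Ctot.
  have fldU X : C X -> fld X `<=` fld (\bigcup_(X in C) X).
    by move=> CX; apply: fldS => p Xp; exists X.
  split.
  - move=> p y [X CX Xpy]; have [X1 _ _ _] := CP _ CX.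
    by have [? ? ?] := X1 _ _ Xpy; split; apply: (fldU X).
  - move=> x [y [X CX Xxy]]; have [_ + _ _] := CP _ CX; apply.
    by exists y.
  - move=> x x' [y [X CX Xxy]] [y' [X' CX' Xxy']].
    have [Z [CZ XZ XZ']] := chain_common _ _ _ Ctot CX CX'.
    have [_ _ + _] := CP _ CZ => /(_ x x')[||z Zz].
    + by exists y; apply: XZ.
    + by exists y'; apply: XZ'.
    + by exists z; exists Z.
  - move=> p p' y [X CX Xp] [X' CX' Xp'].
    have [Z [CZ XZ XZ']] := chain_common _ _ _ Ctot CX CX'.
    by have [_ _ _ +] := CP _ CZ; apply; [apply: XZ Xp|apply: XZ' Xp'].
have [f1 fA f3 f4] := Pf.
have [k kX kinj] : exists2 k : T * T -> T,
    forall p, (fld f `*` fld f) p -> fld f (k p) &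
    forall p p', (fld f `*` fld f) p -> (fld f `*` fld f) p' ->
      k p = k p' -> p = p'.
  by apply: card_le_injection (fld_le _ Pf); exists (i 0); apply: (fldS _ _ f0f).
set X := fld f in fA f3 kX kinj *.
pose e (b : bool) := i b.
have Xe b : X (e b) by apply: (fldS _ _ f0f); apply: fld0.
have XX x x' : X x -> X x' -> (X `*` X) (x, x') by [].
have kXX x x' : X x -> X x' -> X (k (x, x')) by move=> *; apply/kX/XX.
have einj : injective e by move=> [] [] // /iinj.
have [AX|XA] := card_le_total (A `\` X) X.
  have AleX : A #<= X.
    apply: card_le_trans (fld_le _ Pf).
    apply: (card_le_trans (B := A `\` X `|` X)).
      apply: subset_card_le => x Ax.
      by have [?|?] := pselect (X x); [right|left].
    by apply: (@card_setU_le _ _ _ (e true) (e false)) => // /einj.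
  apply: card_le_trans (card_le_trans (fld_le _ Pf) _); last exact: subset_card_le.
  have [|g gX ginj] := card_le_injection _ AleX; first by exists (e true).
  apply: (@card_le_fun _ _ _ _ (fun p => (g p.1, g p.2))).
    by move=> p [? ?]; split; apply: gX.
  by move=> [x y] [x' y'] [? ?] [? ?] [/ginj-> // /ginj->].
(* Otherwise [A `\` X] contains a disjoint copy [g X] of [X], and [f] extends to
   [X `|` g X]: the three new quarters of the square are sent into [g X]. *)
exfalso.
have [|g gA ginj] := card_le_injection _ XA.
  by apply: card_le_neq0 XA; exists (e true).
pose c (b : bool) x := if b then x else g x.
(* The booleans name the quarters of the enlarged square, [true] standing for [X] and [false] for
   [g X]. Coding them by tags keeps the images of distinct quarters disjoint; the quarter with both
   [true] is left to [f]. *)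
pose h b b' x x' := k (k (e b, e b'), k (x, x')).
have hX b b' x x' : X x -> X x' -> X (h b b' x x').
  by move=> *; do 2?apply: (kXX).
have hinj b1 b1' x1 x1' b2 b2' x2 x2' : X x1 -> X x1' -> X x2 -> X x2' ->
    h b1 b1' x1 x1' = h b2 b2' x2 x2' ->
    [/\ b1 = b2, b1' = b2', x1 = x2 & x1' = x2'].
  move=> X1 X1' X2 X2' E.
  have [E1 E2] := kinj _ _ (XX _ _ (kXX _ _ (Xe _) (Xe _)) (kXX _ _ X1 X1'))
    (XX _ _ (kXX _ _ (Xe _) (Xe _)) (kXX _ _ X2 X2')) E.
  have [/einj-> /einj->] := kinj _ _ (XX _ _ (Xe _) (Xe _)) (XX _ _ (Xe _) (Xe _)) E1.
  by have [-> ->] := kinj _ _ (XX _ _ X1 X1') (XX _ _ X2 X2') E2.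
pose f' := f `|` [set p | exists b b' x x', [/\ X x, X x', ~~ (b && b') &
  p = (c b x, c b' x', g (h b b' x x'))]].
have fldf' b x : X x -> fld f' (c b x).
  case: b => Xx; first by apply: (fldS f) => // ?; left.
  by exists (g (h false false x x)); right; exists false, false, x, x.
have fldf'P x : fld f' x -> exists b x0, X x0 /\ x = c b x0.
  move=> [y [fxy|[b [b' [x0 [x0' [Xx Xx' _ [-> _ _]]]]]]]].
    by exists true, x; split=> //; exists y.
  by exists b, x0.
(* Maximality would put this triple into [f], hence [g (e true)] into [X], although [g] takes its
   values outside [X]. *)
have : f' (c false (e true), c false (e true), g (h false false (e true) (e true))).
  by right; exists false, false, (e true), (e true).
move=> /(fmax f') => /(_ _ _)/f1[].
- by move=> ?; left.
- split.
  + move=> p y [/f1[? ? ?]|[b [b' [x [x' [Xx Xx' _ [-> ->]]]]]]] /=.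
      by split; apply: (fldf' true).
    split; [exact: fldf'|exact: fldf'|].
    by apply: (fldf' false); apply: hX.
  + move=> x /fldf'P[[] [x0 [Xx0 ->]]] /=; first exact: fA.
    by have [] := gA _ Xx0.
  + move=> x x' /fldf'P[b [x0 [Xx0 ->]]] /fldf'P[b' [x0' [Xx0' ->]]].
    have [/andP[-> ->]|nbb'] := boolP (b && b').
      by have [y fy] := f3 _ _ Xx0 Xx0'; exists y; left.
    by exists (g (h b b' x0 x0')); right; exists b, b', x0, x0'.
  + have gN y x : X x -> X y -> g x <> y.
      by move=> Xx Xy E; have [_ []] := gA _ Xx; rewrite E.
    move=> p p' y [fp|[b [b' [x [x' [Xx Xx' nb [-> ->]]]]]]]
                 [fp'|[b1 [b1' [x1 [x1' [Xx1 Xx1' nb1 [-> E]]]]]]].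
    * exact: f4 fp fp'.
    * have [_ _ Xy] := f1 _ _ fp; case: (gN y (h b1 b1' x1 x1')) => //.
      exact: hX.
    * have [_ _ Xy] := f1 _ _ fp'.
      by case: (gN _ _ (hX b b' _ _ Xx Xx') Xy).
    * have /hinj[] // := ginj _ _ (hX _ _ _ _ Xx Xx') (hX _ _ _ _ Xx1 Xx1') E.
      by move=> -> -> -> ->.
- move=> /= Xg _ _; have [_ []//] := gA (e true) (Xe true).
Qed.

(** By [card_le_total] this is strict inequality of cardinals. The negated form makes avoidance
    arguments direct. *)
Definition card_lt {T U : Type} (A : set T) (B : set U) : Prop := ~ (B #<= A).

Lemma card_le_setX {T T' U U' : Type} (A : set T) (A' : set T')
    (B : set U) (B' : set U') :
  A #<= A' -> B #<= B' -> A `*` B #<= A' `*` B'.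
Proof.
move=> AA' BB'.
have [->|/set0P A0] := eqVneq A set0; first by rewrite set0X.
have [->|/set0P B0] := eqVneq B set0; first by rewrite setX0.
have [f fA finj] := card_le_injection (card_le_neq0 _ _ A0 AA') AA'.
have [g gB ginj] := card_le_injection (card_le_neq0 _ _ B0 BB') BB'.
apply: (@card_le_fun _ _ _ _ (fun p => (f p.1, g p.2))).
  by move=> p [? ?]; split; [exact: fA|exact: gB].
by move=> [x y] [x' y'] [? ?] [? ?] [/finj-> // /ginj->].
Qed.

(** A point is coded by some index [j] whose [E j] contains it, together with its image under a
    chosen injection of [E j] into [B]. *)
Lemma card_le_bigcup {J T U : Type} (A : set J) (E : J -> set T) (B : set U) :
  B !=set0 -> (forall j, E j #<= B) -> \bigcup_(j in A) E j #<= A `*` B.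
Proof.
move=> B0 EB.
have /choice[f fP] : forall j, exists f : T -> U,
    (forall x, E j x -> B (f x)) /\
    (forall x x', E j x -> E j x' -> f x = f x' -> x = x').
  by move=> j; have [f ? ?] := card_le_injection B0 (EB j); exists f.
apply: (@card_le_rel _ _ _ _ (fun x p => E p.1 x /\ f p.1 x = p.2)).
  move=> x [j Aj Ejx]; exists (j, f j x) => //.
  by split=> //; exact: (fP j).1.
move=> x x' [j u] _ _ /= [Ex fx] [Ex' fx'].
by apply: (fP j).2 => //; rewrite fx.
Qed.

(** * Closure properties of the cardinals below a fixed infinite one *)

Section CardLt.
Context {V : Type} (C : set V) (Cinf : infinite_set C).

Lemma card_lt_le {T U : Type} {A : set T} {B : set U} :
  A #<= B -> card_lt B C -> card_lt A C.
Proof. by move=> AB; apply: contra_not => CA; apply: card_le_trans AB. Qed.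

Lemma card_lt_image {T U : Type} (f : T -> U) (A : set T) :
  card_lt A C -> card_lt (f @` A) C.
Proof. exact/card_lt_le/card_image_le. Qed.

Lemma card_lt_finite {T : Type} (A : set T) : finite_set A -> card_lt A C.
Proof. by move=> Af /card_le_finite/(_ Af). Qed.

(** The product is bounded by the square of the larger factor, which is finite or no larger than
    that factor. *)
Lemma card_lt_setX {T U : Type} {A : set T} {B : set U} :
  card_lt A C -> card_lt B C -> card_lt (A `*` B) C.
Proof.
have sq W (D : set W) : card_lt D C -> card_lt (D `*` D) C.
  move=> DC; have [Df|Dinf] := pselect (finite_set D).
    exact/card_lt_finite/finite_setX.
  exact: card_lt_le (infinite_setX_le _ Dinf) DC.
move=> ltA ltB; have [AB|BA] := card_le_total A B.
  by apply: card_lt_le (sq _ _ ltB); apply: card_le_setX.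
by apply: card_lt_le (sq _ _ ltA); apply: card_le_setX.
Qed.

Lemma card_lt_setU {T : Type} (A B : set T) :
  card_lt A C -> card_lt B C -> card_lt (A `|` B) C.
Proof.
have le D E : card_lt E C -> D #<= E -> card_lt (D `|` E) C.
  move=> EC DE; have [Ef|Einf] := pselect (finite_set E).
    by apply: card_lt_finite; rewrite finite_setU; split=> //; apply: card_le_finite DE _.
  have [|i iE iinj] := card_le_injection _ ((infiniteP E).1 Einf).
    exact: infinite_setN0.
  apply: card_lt_le (card_lt_setX EC EC).
  apply: (@card_setU_le _ _ _ (i 0) (i 1)) => //; [exact: iE|exact: iE|].
  by move=> /(iinj _ _ I I).
move=> ltA ltB; have [AB|BA] := card_le_total A B; first exact: le.
by rewrite setUC; apply: le.
Qed.

Lemma card_lt_avoid {T : Type} (J A : set T) :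
  C #<= J -> card_lt A C -> exists2 x, J x & ~ A x.
Proof.
move=> CJ ltA; apply: contrapT => nx; apply: ltA.
apply: card_le_trans CJ _; apply: subset_card_le => x Jx.
by apply: contrapT => nAx; apply: nx; exists x.
Qed.

End CardLt.

(** * Transfinite construction *)

(** Start from any well-order. If some initial segment is as large as [T], take the least such bound
    [m] and pull the order back along an injection [f] of [T] into the segment below [m]. The new
    segment of [x] injects into the old segment of [f x], which is small because [f x] lies below
    [m]. *)
Lemma initial_well_order (T : eqType) : exists lt : T -> T -> Prop,
  [/\ well_founded lt, forall x y z, lt x y -> lt y z -> lt x z,
      forall x y, [\/ lt x y, x = y | lt y x] &
      forall x, card_lt [set y | lt y x] [set: T]].
Proof.
have [R Rwo] := well_ordering_principle T.
have Rmin (A : set T) : A !=set0 -> exists2 z, A z & forall x, A x -> R z x.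
  move=> [x Ax]; have [|z [[Az zmin] _]] := Rwo [pred x | `[< A x >]].
    by exists x; apply/asboolP.
  exists z; first exact/asboolP.
  by move=> y Ay; apply: zmin; apply/asboolP.
have Rtot x y : R x y \/ R y x.
  have [|z [->|->] zmin] := Rmin [set x; y]; first by exists x; left.
  - by left; apply: zmin; right.
  - by right; apply: zmin; left.
have Rrefl x : R x x by case: (Rtot x x).
(* Both points would be minima of the pair, and minima are unique. *)
have Ranti x y : R x y -> R y x -> x = y.
  move=> xy yx; have [|z [_ zu]] := Rwo (pred2 x y).
    by exists x; rewrite inE eqxx.
  rewrite -(zu x) ?(zu y) //; split; rewrite ?inE ?eqxx ?orbT //.
    by move=> w; rewrite inE => /orP[]/eqP->.
  by move=> w; rewrite inE => /orP[]/eqP->.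
have Rtrans x y z : R x y -> R y z -> R x z.
  move=> xy yz; have [|w ww wmin] := Rmin [set x; y; z].
    by exists x; left; left.
  have [wx wy wz] : [/\ R w x, R w y & R w z].
    by split; apply: wmin; [left; left|left; right|right].
  move: ww wx wy wz => [[->//|->]|->] wx wy wz.
    by rewrite (Ranti _ _ xy wx).
  by rewrite -(Ranti _ _ yz wy).
pose lt x y := R x y /\ x <> y.
have lt_wf : well_founded lt.
  move=> x; apply: contrapT => nx.
  have [|z nz zmin] := Rmin [set x | ~ Acc lt x]; first by exists x.
  apply: nz; constructor => y [yz nyz]; apply: contrapT => ny.
  by apply/nyz/Ranti => //; apply: zmin.
have lt_trans x y z : lt x y -> lt y z -> lt x z.
  move=> [xy nxy] [yz nyz]; split; first exact: Rtrans yz.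
  by move=> xz; apply: nxy; apply: Ranti => //; rewrite xz.
have lt_tot x y : [\/ lt x y, x = y | lt y x].
  have [->|/eqP nxy] := eqVneq x y; first by constructor 2.
  by have [?|?] := Rtot x y; [constructor 1|constructor 3; split=> // /esym].
have [?|/existsNP[m0 m0P]] := pselect (forall x, card_lt [set y | lt y x] [set: T]).
  by exists lt.
have [|m mP mmin] := Rmin [set m | ~ card_lt [set y | lt y m] [set: T]].
  by exists m0.
have Tm : [set: T] #<= [set y | lt y m] by apply: contrapT.
have [|f fm finj] := card_le_injection _ Tm.
  by apply: card_le_neq0 Tm; exists m.
exists (fun x y => lt (f x) (f y)); split.
- exact: wf_inverse_image.
- by move=> x y z; apply: lt_trans.
- move=> x y; have [?|/(finj _ _ I I)?|?] := lt_tot (f x) (f y);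
    by [constructor 1|constructor 2|constructor 3].
- move=> x; apply: (@card_lt_le _ _ _ _ _ [set y | lt y (f x)]).
    by apply: (@card_le_fun _ _ _ _ f) => // ? ? _ _; apply: finj.
  apply: contrapT => /mmin mfx; have [fxm nfxm] := fm x I.
  by apply: nfxm; apply: Ranti.
Qed.

(** Stage [k] adds at most two points to the union [U k] of the earlier additions. So [U k] has size
    at most twice that of a proper initial segment of [K], hence less than [K], and [step] applies.
    Goodness of the empty set comes from the empty chain. *)
Lemma transfinite_construction {K : eqType} {T : Type}
    (good : set (set T)) (task : K -> set (set T)) :
  infinite_set [set: K] ->
  (forall C, C `<=` good -> total_on C subset -> good (\bigcup_(S in C) S)) ->
  (forall k S S', S `<=` S' -> task k S -> task k S') ->
  (forall k S, good S -> card_lt S [set: K] -> exists E : set T,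
     [/\ E #<= [set: bool], good (S `|` E) & task k (S `|` E)]) ->
  exists2 S, good S & forall k, task k S.
Proof.
move=> Kinf good_chain task_mono step.
have [lt [lt_wf lt_trans lt_tot lt_small]] := initial_well_order K.
(* The bound on [E] holds even when [Sk.1] is not good, so the smallness of every [U k] can be
   proved before any goodness. *)
have /choice[f fP] : forall Sk : set T * K, exists E : set T,
    E #<= [set: bool] /\ (good Sk.1 -> card_lt Sk.1 [set: K] ->
      good (Sk.1 `|` E) /\ task Sk.2 (Sk.1 `|` E)).
  move=> [S k] /=.
  have [[gS sS]|nS] := pselect (good S /\ card_lt S [set: K]).
    by have [E [? ? ?]] := step k S gS sS; exists E.
  by exists set0; split=> // gS sS; case: nS.
pose F k (e : forall j, lt j k -> set T) :=
  f ([set x | exists j (jk : lt j k), e j jk x], k).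
pose e := Fix lt_wf (fun _ => set T) F.
pose U k := \bigcup_(j in [set j | lt j k]) e j.
have eE k : e k = f (U k, k).
  rewrite /e Fix_eq -/e.
    congr (f (_, k)); apply/seteqP; split=> [x [j [jk ejx]]|x [j jk ejx]].
      by exists j.
    by exists j, jk.
  move=> j g h gh; congr F.
  by apply: functional_extensionality_dep => y;
    apply: functional_extensionality_dep => p.
have e_bool k : e k #<= [set: bool] by rewrite eE; exact: (fP _).1.
have U_small k : card_lt (U k) [set: K].
  apply: (@card_lt_le _ _ _ _ _ ([set j | lt j k] `*` [set: bool])).
    by apply: card_le_bigcup => //; exists true.
  by apply: card_lt_setX => //; apply: card_lt_finite.
pose W k := U k `|` e k.
have W_U j k : lt j k -> W j `<=` U k.
  move=> jk x [[i ij eix]|ejx]; last by exists j.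
  by exists i => //; apply: lt_trans jk.
have W_mono j k : lt j k -> W j `<=` W k.
  by move=> jk x /(W_U _ _ jk) Ukx; left.
have W_chain (D : set K) : total_on [set W j | j in D] subset.
  move=> _ _ [j _ <-] [k _ <-].
  by have [/W_mono?|->|/W_mono?] := lt_tot j k; [left|left|right].
(* The increments [e j] need not be good, but the cumulative stages [W j] are, and they form a
   chain. *)
have UE k : U k = \bigcup_(S in [set W j | j in [set j | lt j k]]) S.
  apply/seteqP; split=> [x [j jk ejx]|x [_ [j jk <-] /(W_U _ _ jk)//]].
  by exists (W j); [exists j|right].
have W_good : forall k, good (W k) /\ task k (W k).
  apply: (well_founded_ind lt_wf) => k IH.
  have Uk : good (U k).
    rewrite UE; apply: good_chain => // _ [j jk <-].
    exact: (IH j jk).1.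
  by rewrite /W eE; exact: (fP (U k, k)).2 Uk (U_small k).
exists (\bigcup_(S in [set W k | k in [set: K]]) S).
  by apply: good_chain => // _ [k _ <-]; exact: (W_good k).1.
move=> k; apply: task_mono (W_good k).2.
by move=> x Wkx; exists (W k) => //; exists k.
Qed.

(** * Partial terraces *)

(** The equivalence says that [S] is both functional and injective. The product [p.2 * q.2] replaces
    [p.2^-1 * q.2], as every element will be its own inverse. Difference zero is excluded because
    all its products are trivial. *)
Definition partial_terrace {F : realFieldType} {G : groupType} (I : set F)
    (S : set (F * G)) : Prop :=
  [/\ forall p, S p -> I p.1,
      forall p q, S p -> S q -> p.1 = q.1 <-> p.2 = q.2 &
      forall p q r s, S p -> S q -> S r -> S s -> p.1 <> q.1 ->
        (q.1 - p.1 = s.1 - r.1)%R -> (p.2 * q.2 = r.2 * s.2)%g -> p.1 = r.1].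

Section ElementaryAbelian.
Context {G : groupType} {F : realFieldType} (I : set F).
Context (mulgC : forall x y : G, commute x y).
Context (mulgg : forall x : G, (x * x = 1)%g).

Lemma mulggK (x y : G) : (x * (x * y) = y)%g.
Proof. by rewrite mulgA mulgg mul1g. Qed.

Lemma partial_terrace_bigcup (C : set (set (F * G))) :
  C `<=` partial_terrace I -> total_on C subset ->
  partial_terrace I (\bigcup_(S in C) S).
Proof.
move=> CP Ctot; split=> [p [S /CP[+ _ _]]|p q|p q r s]; first exact.
  move=> [X CX Xp] [Y CY Yq].
  have [Z [CZ XZ YZ]] := chain_common _ _ _ Ctot CX CY.
  by have [_ + _] := CP _ CZ; apply; [apply: XZ|apply: YZ].
move=> [X CX Xp] [Y CY Yq] [X' CX' Xr] [Y' CY' Ys].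
have [Z [CZ XZ YZ]] := chain_common _ _ _ Ctot CX CY.
have [Z' [CZ' XZ' YZ']] := chain_common _ _ _ Ctot CX' CY'.
have [U [CU ZU ZU']] := chain_common _ _ _ Ctot CZ CZ'.
have [_ _ +] := CP _ CU; apply.
- exact/ZU/XZ.
- exact/ZU/YZ.
- exact/ZU'/XZ'.
- exact/ZU'/YZ'.
Qed.

(* Two new pairs [(i, p)], [(q, i)] with the same difference never clash:
   [x * p.2 = q.2 * x] forces [p = q], hence [i = p.1]. So only clashes with an
   old pair have to be excluded. *)
Lemma partial_terrace_setU1 (S : set (F * G)) (i : F) (x : G) :
  partial_terrace I S -> I i ->
  (forall p, S p -> p.1 <> i) -> (forall p, S p -> p.2 <> x) ->
  (forall p q r, S p -> S q -> S r -> (i - p.1 = r.1 - q.1)%R ->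
    (x * p.2 <> q.2 * r.2)%g) ->
  partial_terrace I (S `|` [set (i, x)]).
Proof.
move=> [SI Sinj Sdiff] Ii ni nx new.
split=> [p [/SI//|->//]|p q [Sp|->] [Sq|->]|].
- exact: Sinj.
- by split=> /= ?; [case: (ni _ Sp)|case: (nx _ Sp)].
- by split=> /= /esym ?; [case: (ni _ Sq)|case: (nx _ Sq)].
- by [].
move=> p q r s [Sp|->] [Sq|->] [Sr|->] [Ss|->] //=.
- exact: Sdiff.
- move=> _ eqd eqm; exfalso; apply: (new _ _ _ Sr Sp Sq); first lra.
  by rewrite mulgC -eqm.
- move=> _ eqd eqm; exfalso; apply: (new _ _ _ Ss Sq Sp); first lra.
  by rewrite -eqm mulgC.
- by move=> npq eqd; exfalso; apply: npq; lra.
- move=> _ eqd eqm; exfalso; apply: (new _ _ _ Sp Sr Ss); first lra.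
  by rewrite mulgC eqm.
- by move=> _ eqd _; lra.
- move=> _ eqd eqm; exfalso; apply: (ni _ Sp).
  have /Sinj : p.2 = s.2.
    by apply: (mulgI x); rewrite -eqm mulgC.
  by move=> /(_ Sp Ss) ?; lra.
- by move=> _ eqd _; lra.
- move=> _ eqd eqm; exfalso; apply: (new _ _ _ Sq Ss Sr); first lra.
  by rewrite eqm mulgC.
- move=> _ eqd eqm; exfalso; apply: (ni _ Sq).
  have /Sinj : q.2 = r.2 by apply: (mulgI x); rewrite eqm mulgC.
  by move=> /(_ Sq Sr) ?; lra.
Qed.

(** * Extensions meeting a single requirement *)

Context {V : Type} (C : set V) (Cinf : infinite_set C).
Let small {T : Type} (A : set T) := card_lt A C.

Lemma pair_card_le {T : Type} (p q : T) : [set p; q] #<= [set: bool].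
Proof.
apply: card_le_trans (card_image_le (fun b : bool => if b then p else q) _).
by apply: subset_card_le => _ [->|->]; [exists true|exists false].
Qed.

Lemma partial_terrace_dom (S : set (F * G)) (i : F) :
  C #<= [set: G] -> partial_terrace I S -> small S -> I i ->
  exists E : set (F * G), [/\ E #<= [set: bool],
    partial_terrace I (S `|` E) & exists x, (S `|` E) (i, x)].
Proof.
move=> CG St Ssmall Ii.
have [[x Six]|ni] := pselect (exists x, S (i, x)).
  by exists set0; rewrite setU0; split=> //; exists x.
(* A clash means that [x] is a product of three old values. Equal factors give the old values
   themselves, since [y * y * y = y], so injectivity is covered too. *)
have [x _ xavoid] : exists2 x, [set: G] x &
    ~ [set (p.1.2 * p.2.1.2 * p.2.2.2)%g | p in S `*` (S `*` S)] x.
  by apply: card_lt_avoid CG _; apply: card_lt_image; do 2?apply: card_lt_setX.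
exists [set (i, x)]; split; last by exists x; right.
  by rewrite -(setUid [set _]); apply: pair_card_le.
apply: partial_terrace_setU1 => //.
- by move=> [j y] Sp /= ij; apply: ni; exists y; rewrite -ij.
- by move=> p Sp px; apply: xavoid; exists (p, (p, p)); rewrite //= mulgg mul1g.
- move=> p q r Sp Sq Sr _ E; apply: xavoid; exists (p, (q, r)) => //=.
  by rewrite -mulgA -E (mulgC x) mulggK.
Qed.

Lemma partial_terrace_codom (S : set (F * G)) (x : G) :
  C #<= I -> partial_terrace I S -> small S ->
  exists E : set (F * G), [/\ E #<= [set: bool],
    partial_terrace I (S `|` E) & exists i, (S `|` E) (i, x)].
Proof.
move=> CI St Ssmall.
have [[i Six]|nx] := pselect (exists i, S (i, x)).
  by exists set0; rewrite setU0; split=> //; exists i.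
have [i Ii iavoid] : exists2 i, I i &
    ~ [set (p.1.1 - p.2.1.1 + p.2.2.1)%R | p in S `*` (S `*` S)] i.
  by apply: card_lt_avoid CI _; apply: card_lt_image; do 2?apply: card_lt_setX.
exists [set (i, x)]; split; last by exists i; right.
  by rewrite -(setUid [set _]); apply: pair_card_le.
apply: partial_terrace_setU1 => //.
- by move=> p Sp pi; apply: iavoid; exists (p, (p, p)) => //=; lra.
- by move=> [j y] Sp /= xy; apply: nx; exists j; rewrite -xy.
- move=> p q r Sp Sq Sr E _; apply: iavoid; exists (p, (q, r)) => //=; lra.
Qed.

(** First [i] is chosen to rule out every avoidable coincidence of differences; then [x] only has to
    keep the values [x] and [x * g] new. *)
Lemma partial_terrace_diff (S : set (F * G)) (d : F) (g : G) :
  C #<= [set: G] -> C #<= shift_set I d -> (0 < d)%R -> g <> 1%g ->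
  partial_terrace I S -> small S ->
  exists E : set (F * G), [/\ E #<= [set: bool],
    partial_terrace I (S `|` E) &
    exists p q, [/\ (S `|` E) p, (S `|` E) q, q.1 = (p.1 + d)%R &
      (p.2 * q.2 = g)%g]].
Proof.
move=> CG CI d0 g1 St Ssmall.
have [[p [q [Sp Sq qp pqg]]]|ndg] := pselect (exists p q,
    [/\ S p, S q, q.1 = (p.1 + d)%R & (p.2 * q.2 = g)%g]).
  by exists set0; rewrite setU0; split=> //; exists p, q.
have {}ndg p q : S p -> S q -> q.1 = (p.1 + d)%R -> (p.2 * q.2)%g <> g.
  by move=> Sp Sq pq pqg; apply: ndg; exists p, q.
(* The first two sets ensure that [i] and [i + d] are new and that their differences with old points
   are not old differences. The third prevents an old point from preceding [i] by [d]. The fourth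
   prevents the difference from an old point to [i + d] from equalling that from [i] to an old
   point. *)
have [i [Ii Iid] iavoid] : exists2 i, shift_set I d i &
    ~ ([set (p.1.1 - p.2.1.1 + p.2.2.1)%R | p in S `*` (S `*` S)] `|`
       [set (p.1.1 - p.2.1.1 + p.2.2.1 - d)%R | p in S `*` (S `*` S)] `|`
       [set (p.1 + d)%R | p in S] `|`
       [set ((p.1.1 + p.2.1 - d) / 2%:R)%R | p in S `*` S]) i.
  apply: card_lt_avoid CI _; do 3?[apply: card_lt_setU => //];
    by apply: card_lt_image => //; do 2?apply: card_lt_setX.
move: iavoid => /not_orP[/not_orP[/not_orP[a1 a2] a3] a4].
have {}a1 p q r : S p -> S q -> S r -> i <> (p.1 - q.1 + r.1)%R.
  by move=> Sp Sq Sr E; apply: a1; exists (p, (q, r)).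
have {}a2 p q r : S p -> S q -> S r -> (i + d)%R <> (p.1 - q.1 + r.1)%R.
  by move=> Sp Sq Sr E; apply: a2; exists (p, (q, r)) => //=; lra.
have {}a3 p : S p -> (p.1 + d)%R <> i by move=> Sp E; apply: a3; exists p.
have {}a4 p q : S p -> S q -> (i + i <> p.1 + q.1 - d)%R.
  by move=> Sp Sq E; apply: a4; exists (p, q) => //=; lra.
have [x _ xavoid] : exists2 x, [set: G] x &
    ~ ([set p.2 | p in S] `|` [set (p.2 * g)%g | p in S]) x.
  by apply: card_lt_avoid CG _; apply: card_lt_setU => //; apply: card_lt_image.
have {xavoid} [nx nxg] : (forall p, S p -> p.2 <> x) /\
    (forall p, S p -> p.2 <> (x * g)%g).
  split=> p Sp E; apply: xavoid; [left|right]; exists p => //.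
  by rewrite E -mulgA mulgg mulg1.
have d_ne i' : (i' <> i' + d)%R by move=> ?; lra.
have S1 : partial_terrace I (S `|` [set (i, x)]).
  apply: partial_terrace_setU1 => // [p Sp E|p q r Sp Sq Sr E _].
    by apply: (a1 _ _ _ Sp Sp Sp); lra.
  by apply: (a1 _ _ _ Sp Sq Sr); lra.
exists [set (i, x); ((i + d)%R, (x * g)%g)]; split.
- exact: pair_card_le.
- rewrite setUA; apply: partial_terrace_setU1 => //.
  + by move=> p [Sp E|->]; [apply: (a2 _ _ _ Sp Sp Sp); lra|exact: d_ne].
  + move=> p [Sp|-> /= E]; first exact: nxg.
    by apply: g1; apply: (mulgI x); rewrite -E mulg1.
  + move=> p q r [Sp|->] [Sq|->] [Sr|->] /= E.
    * by move=> _; apply: (a2 _ _ _ Sp Sq Sr); lra.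
    (* No choice of [i] excludes this coincidence, which says [p.1 = q.1 + d]. Cancelling [x] shows
       that old points already attain [g] at difference [d]. The case of [p] new with [q] and [r]
       old ends likewise. *)
    * rewrite -mulgA -(mulgC x) => /mulgI E'.
      apply: (ndg _ _ Sq Sp); first lra.
      by rewrite -E' -mulgA mulgg mulg1.
    * by move=> _; apply: (a4 _ _ Sp Sr); lra.
    * by move=> _; apply: (a2 _ _ _ Sp Sp Sp); lra.
    * move=> E'; apply: (ndg _ _ Sq Sr); first lra.
      by rewrite -E' mulgC mulggK.
    * by move=> _; apply: (a3 _ Sq); lra.
    * by move=> _; apply: (a2 _ _ _ Sr Sr Sr); lra.
    * by move=> _; lra.
- exists (i, x), ((i + d)%R, (x * g)%g); split=> //=.
  + by right; left.
  + by right; right.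
  + exact: mulggK.
Qed.

End ElementaryAbelian.

(** * Scheduling the requirements and reading off the terrace *)

Theorem theorem2p4 (G : groupType)
    (Ginf : infinite_set [set: G])
    (Gabelian : forall x y : G, commute x y)
    (Ginvol : forall x : G, x <> 1%g -> is_involution x)
    (F : realFieldType) (I : set F)
    (Iindex : index_set I) (IG : I #= [set: G]) :
  exists a : F -> G, directed_Tinf_terrace I a.
Proof.
have mulgg (x : G) : (x * x = 1)%g.
  by have [->|/eqP/Ginvol[]//] := eqVneq x 1%g; rewrite mulg1.
have invgg (x : G) : (x^-1 = x)%g by apply: (mulgI x); rewrite mulgV mulgg.
have [IF Ishift] := Iindex.
have GI : [set: G] #<= I by rewrite (card_le_eqr IG).
have FI : [set: F] #<= I by rewrite (card_le_eqr IF).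
have Iinf : infinite_set I by apply: contra_not Ginf; apply: card_le_finite.
(* The requirements are indexed by [F * G], which is no larger than [I] and [G]. *)
have KI : [set: F * G] #<= I.
  apply: card_le_trans (infinite_setX_le _ Iinf); rewrite -setXTT.
  exact: card_le_setX.
have KG : [set: F * G] #<= [set: G] by rewrite -(card_le_eqr IG).
have Kinf : infinite_set [set: F * G].
  apply: contra_not Ginf; apply: card_le_finite.
  by apply: (@card_le_fun _ _ _ _ (fun g => (0%R, g))) => // ? ? _ _ [].
(* The index set property makes each nonempty shift set large enough for the choice of [i] in
   [partial_terrace_diff]. *)
have Kshift d : (0 < d)%R -> shift_set I d !=set0 ->
    [set: F * G] #<= shift_set I d.
  move=> d0 /set0P Id0; have [E|E] := Ishift d d0; last by rewrite E eqxx in Id0.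
  by rewrite (card_le_eqr E) -(card_le_eqr IF).
(* [tau] names a point of [I] by an element of [G], so that domain requirements also fit into
   [F * G]. *)
have [tau _ tau_inj] : exists2 tau : F -> G, forall i, I i -> [set: G] (tau i) &
    forall i j, I i -> I j -> tau i = tau j -> i = j.
  by apply: card_le_injection; [exists 1%g|rewrite -(card_le_eqr IG)].
(* The sign of [k.1] selects the kind of requirement: domain, range, or
   difference [k.1] with product [k.2]. *)
pose task (k : F * G) (S : set (F * G)) :=
  [/\ (k.1 < 0)%R -> forall i, I i -> tau i = k.2 -> exists x, S (i, x),
      k.1 = 0%R -> exists i, S (i, k.2) &
      (0 < k.1)%R -> shift_set I k.1 !=set0 -> k.2 <> 1%g -> exists p q,
        [/\ S p, S q, q.1 = (p.1 + k.1)%R & (p.2 * q.2 = k.2)%g]].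
have [||[c g] S St Ssmall|S [SI Sinj Sdiff] Stask] :=
  transfinite_construction (partial_terrace I) task Kinf.
- exact: partial_terrace_bigcup.
- move=> k S S' SS' [t1 t2 t3]; split=> [c0 i Ii E|c0|c0 ds k1].
  + by have [x ?] := t1 c0 i Ii E; exists x; apply: SS'.
  + by have [i ?] := t2 c0; exists i; apply: SS'.
  + have [p [q [? ? ? ?]]] := t3 c0 ds k1.
    by exists p, q; split=> //; apply: SS'.
- have task0 : partial_terrace I (S `|` set0) by rewrite setU0.
  rewrite /task /=; have [c0|c0|->] := ltgtP c 0%R.
  + have [[i [Ii ig]]|ni] := pselect (exists i, I i /\ tau i = g).
      have [E [E2 SE [x SEx]]] := partial_terrace_dom I Gabelian mulgg
        [set: F * G] Kinf S i KG St Ssmall Ii.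
      exists E; split=> //; split=> [_ j Ij jg|?|]; [|lra|by []].
      by exists x; rewrite (tau_inj j i) // jg.
    (* Here [g] names no point of [I], and the requirement is void. *)
    exists set0; split=> //; split=> [_ j Ij jg|?|]; [|lra|by []].
    by case: ni; exists j.
  + have [[/(Kshift _ c0) ds g1]|n] := pselect (shift_set I c !=set0 /\ g <> 1%g).
      have [E [E2 SE ?]] := partial_terrace_diff I Gabelian mulgg
        [set: F * G] Kinf S c g KG ds c0 g1 St Ssmall.
      by exists E; split=> //; split=> // ?; lra.
    exists set0; split=> //; split=> [//|?|_ ds g1]; first lra.
    by case: n.
  + have [E [E2 SE ?]] := partial_terrace_codom I Gabelian [set: F * G] Kinf S g
      KI St Ssmall.
    by exists E; split.
have /choice[a aS] : forall i, exists x, I i -> S (i, x).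
  move=> i; have [Ii|nIi] := pselect (I i); last by exists 1%g.
  have [t _ _] := Stask ((-1)%R, tau i).
  by have [|x ?] := t _ i Ii erefl; [rewrite /=; lra|exists x].
have aP p : S p -> a p.1 = p.2.
  move=> Sp; have Sa := aS _ (SI _ Sp).
  by apply/(Sinj _ _ Sa Sp).
have a_inj i j : I i -> I j -> a i = a j -> i = j.
  by move=> /aS Si /aS Sj; apply/(Sinj _ _ Si Sj).2.
exists a; split.
  split=> // [i j|g _]; first by rewrite !inE; apply: a_inj.
  have [_ t _] := Stask (0%R, g); have [i Sig] := t erefl.
  by exists i; [exact: SI Sig|exact: aP Sig].
move=> d d0 ds; split.
- move=> i [Ii Iid] /=; rewrite invgg -(mulgg (a i)) => /mulgI.
  by move=> /(a_inj _ _ Iid Ii); lra.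
- move=> i j; rewrite !inE => -[Ii Iid] [Ij Ijd]; rewrite !invgg => E.
  have := Sdiff _ _ _ _ (aS _ Ii) (aS _ Iid) (aS _ Ij) (aS _ Ijd).
  by apply=> //= ; lra.
- move=> g /= g1; have [_ _ t] := Stask (d, g).
  have [p [q [Sp Sq pq pqg]]] := t d0 ds g1.
  have [Ip Iq] := (SI _ Sp, SI _ Sq).
  exists p.1; first by split=> //; rewrite -pq.
  by rewrite invgg -pq !aP.
Qed.
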